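(* Suppose that $\mathcal P\subset F\subset E$ are quasi-normed linear spaces and that $E$ and $F$ are complete. Suppose that there exist $C>0$ and $\beta>0$ such that for any $f\in F$ the Jackson-type inequality $$t^\beta\,\mathcal E(f,t,E,\mathcal P)\le C\|f\|_F,\qquad t>0,$$ holds. Then the following embedding holds true: $$(E,F)^K_{\theta,q}\subset\mathcal E_{\theta\beta,q}(E,\mathcal P),\qquad 0<\theta<1,\ 1<q\le\infty,$$ i.e. every element of $(E,F)^K_{\theta,q}$ belongs to $\mathcal E_{\theta\beta,q}(E,\mathcal P)$ and its quasi-norm in $\mathcal E_{\theta\beta,q}(E,\mathcal P)$ is bounded by a constant (independent of the element) times its quasi-norm in $(E,F)^K_{\theta,q}$.
   Context: A quasi-norm on a linear space $E$ is a real-valued function $\|\cdot\|_E$ on $E$ with, for all $f,f_1,f_2\in E$: (1) $\|f\|_E\ge0$; (2) $\|f\|_E=0\iff f=0$; (3) $\|-f\|_E=\|f\|_E$; (4) $\|f_1+f_2\|_E\le C_E(\|f_1\|_E+\|f_2\|_E)$ for some constant $C_E>1$. (Homogeneity is not assumed.) Two quasi-normed linear spaces $E,F$ form a pair if they are linear subspaces of a common linear space $\mathcal A$ and $\|f_k-g\|_E\to0$, $\|f_k-h\|_F\to0$ imply $g=h$; as throughout, interpolation and approximation spaces are considered for such pairs. Peetre's $K$-functional on $E+F$ is $$K(f,t)=K(f,t,E,F)=\inf_{f=f_0+f_1,\ f_0\in E,\ f_1\in F}\big(\|f_0\|_E+t\|f_1\|_F\big).$$ $(E,F)^K_{\theta,q}$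 is the quasi-normed linear space of all $f\in E+F$ with finite $$\|f\|_{\theta,q}=\left(\int_0^\infty\big(t^{-\theta}K(f,t)\big)^q\frac{dt}{t}\right)^{1/q}$$ (supremum over $t>0$ of $t^{-\theta}K(f,t)$ if $q=\infty$). The approximation functional is $$\mathcal E(f,t,E,\mathcal P)=\inf_{g\in\mathcal P,\ \|g\|_{\mathcal P}\le t}\|f-g\|_E,$$ and, for $0<\alpha<\infty$, $0<q\le\infty$, the approximation space $\mathcal E_{\alpha,q}(E,\mathcal P)$ is the quasi-normed linear space of all $f\in E+\mathcal P$ with finite quasi-norm $$\left(\int_0^\infty\big(t^\alpha\mathcal E(f,t,E,\mathcal P)\big)^q\frac{dt}{t}\right)^{1/q}$$ (supremum over $t>0$ of $t^\alpha\mathcal E(f,t,E,\mathcal P)$ if $q=\infty$). *)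

(* Defs.v *)
From HB Require Import structures.
From mathcomp Require Import all_boot all_order all_algebra.
From mathcomp Require Import all_classical all_reals all_analysis.

Set Implicit Arguments.
Unset Strict Implicit.
Unset Printing Implicit Defensive.

Import Order.TTheory GRing.Theory Num.Theory.
Import numFieldNormedType.Exports.

Local Open Scope classical_set_scope.
Local Open Scope ring_scope.

(* A quasi-normed linear space, given as a linear subspace of an ambient linear
   space A.  The values of qnorm outside the subspace are irrelevant. *)
Record quasiNormedSpace (R : realType) (k : fieldType) (A : lmodType k) :=
  QuasiNormedSpace {
    qspace :> submodClosed A;
    qnorm : A -> R;
    qnorm_ge0 : forall f, f \in qspace -> 0 <= qnorm f;
    qnorm_eq0 : forall f, f \in qspace -> (qnorm f = 0 <-> f = 0);
    qnormN : forall f, f \in qspace -> qnorm (- f) = qnorm f;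
    qnormD : exists2 C : R, 1 < C & forall f1 f2,
      f1 \in qspace -> f2 \in qspace ->
      qnorm (f1 + f2) <= C * (qnorm f1 + qnorm f2) }.

Section QuasiNormedSpaces.
Variables (R : realType) (k : fieldType) (A : lmodType k).
Implicit Types E F P : quasiNormedSpace R A.

Definition qconverges E (u : nat -> A) (l : A) : Prop :=
  (fun n => qnorm E (u n - l)) @ \oo --> (0 : R).

Definition qcauchy E (u : nat -> A) : Prop :=
  forall e : R, 0 < e -> exists N : nat, forall m n : nat,
    (N <= m)%N -> (N <= n)%N -> qnorm E (u m - u n) < e.

Definition qcomplete E : Prop :=
  forall u : nat -> A, (forall n, u n \in E) -> qcauchy E u ->
    exists2 l, l \in E & qconverges E u l.

Definition compatible_pair E F : Prop :=
  forall (u : nat -> A) (g h : A),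
    (forall n, u n \in E) -> (forall n, u n \in F) -> g \in E -> h \in F ->
    qconverges E u g -> qconverges F u h -> g = h.

Definition sum_space E F : set A :=
  [set f | exists f0 f1, [/\ f0 \in E, f1 \in F & f = f0 + f1]].

Definition Kfunctional E F (f : A) (t : R) : \bar R :=
  ereal_inf [set x | exists f0 f1, [/\ f0 \in E, f1 \in F, f = f0 + f1 &
    x = (qnorm E f0 + t * qnorm F f1)%:E]].

(* The condition f - g \in E is implicit in writing the E-quasi-norm of f - g;
   it is automatic when f \in E and P is a subspace of E. *)
Definition approx_functional E P (f : A) (t : R) : \bar R :=
  ereal_inf [set x | exists g,
    [/\ g \in P, qnorm P g <= t, f - g \in E & x = (qnorm E (f - g))%:E]].

(* The L^q(]0, +oo[, dt/t) quasi-norm of a nonnegative function, 0 < q <= +oo;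
   the value at q = -oo is a dummy. *)
Definition Lq_dtt (q : \bar R) (phi : R -> \bar R) : \bar R :=
  match q with
  | r%:E => ((\int[lebesgue_measure]_(t in `]0%R, +oo[)
               ((phi t) `^ r * (t^-1)%:E)) `^ r^-1)%E
  | +oo%E => ereal_sup [set phi t | t in `]0, +oo[]
  | -oo%E => 0%E
  end.

Definition interp_qnorm E F (theta : R) (q : \bar R) (f : A) : \bar R :=
  Lq_dtt q (fun t => ((t `^ (- theta))%:E * Kfunctional E F f t)%E).

Definition interp_space E F (theta : R) (q : \bar R) : set A :=
  [set f | sum_space E F f /\ (interp_qnorm E F theta q f < +oo)%E].

Definition approx_qnorm E P (alpha : R) (q : \bar R) (f : A) : \bar R :=
  Lq_dtt q (fun t => ((t `^ alpha)%:E * approx_functional E P f t)%E).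

Definition approx_space E P (alpha : R) (q : \bar R) : set A :=
  [set f | sum_space E P f /\ (approx_qnorm E P alpha q f < +oo)%E].

Definition embedding (X : set A) (normX : A -> \bar R)
    (Y : set A) (normY : A -> \bar R) : Prop :=
  X `<=` Y /\
  exists2 M : R, 0 < M & forall f, X f -> (normY f <= M%:E * normX f)%E.

End QuasiNormedSpaces.

(* Main.v *)
Require Import Defs.
From HB Require Import structures.
From mathcomp Require Import all_boot all_order all_algebra.
From mathcomp Require Import all_classical all_reals all_analysis.
From mathcomp Require Import measurable_realfun.
From mathcomp Require Import ring lra.
Import numFieldNormedType.Exports.
Import Order.TTheory GRing.Theory Num.Theory.
Local Open Scope classical_set_scope.
Local Open Scope ring_scope.

(** Split f = f0 + f1 with f0 in E and f1 in F.  Any approximant g of f1 also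
    approximates f, so the quasi-triangle inequality and the Jackson inequality
    for f1 give E(f, t) <= M (|f0|_E + t^-beta |f1|_F), and the infimum over all
    splittings is E(f, t) <= M K(f, t^-beta)
    (lemma approx_functional_le_Kfunctional).  Multiplied by t^(theta beta), this
    compares the approximation integrand at t with the interpolation integrand
    at t^-beta, and for q = +oo the theorem is the resulting comparison of suprema.

    For finite q one has to compare integrals against dt/t under t |-> t^-beta,
    of functions that are merely monotone, hence measurable but possibly
    discontinuous.  Rather than an exact change of variables, a multiplicative
    averaging is used: K(f, u) is nondecreasing in u and u^-theta varies by a
    bounded factor on dyadic intervals, so the pointwise bound persists, with a
    larger constant, for all u in the interval [t^-beta, 2 t^-beta].  That
    interval has du/u-mass at least 1/2, so the integrand at t is at most twice
    the du/u-integral of the other one over it, and Tonelli's theorem exchanges the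
    integrations: for fixed u, the admissible t form an interval
    [a, 2^(1/beta) a], of dt/t-mass bounded independently of u
    (lemma le_integral_dtt_powR). *)

Set Implicit Arguments.
Unset Strict Implicit.
Unset Printing Implicit Defensive.

(** * Integrals against dt/t *)

Section Integral.
Context {R : realType}.
Local Notation pos := (`]0, +oo[%classic : set R).
Local Notation mu := (@lebesgue_measure R).

Lemma posE (x : R) : pos x <-> 0 < x.
Proof. by rewrite /= in_itv/= andbT. Qed.

(** The preimages of the rays [r, +oo] are intervals. *)
Lemma emeasurable_nondecreasing (D : set R) (f : R -> \bar R) :
  is_interval D ->
  (forall x y, D x -> D y -> x <= y -> (f x <= f y)%E) -> measurable_fun D f.
Proof.
move=> Ditv fmon mD; apply: (measurability _ (ErealGenCInfty.measurableE R)) => //.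
move=> /= _ [_ [r ->] <-]; apply: is_interval_measurable.
move=> x y /= [Dx fx] [Dy _] z /andP[xz zy].
have Dz : D z by apply: (Ditv x y) => //; rewrite xz zy.
split=> //; move: fx; rewrite /= !in_itv/= !andbT => /le_trans; apply.
exact: fmon.
Qed.

Lemma emeasurable_nonincreasing (D : set R) (f : R -> \bar R) :
  is_interval D ->
  (forall x y, D x -> D y -> x <= y -> (f y <= f x)%E) -> measurable_fun D f.
Proof.
move=> Ditv fmon.
have -> : f = (\- (\- f))%E by apply/funext => x /=; rewrite oppeK.
apply: measurableT_comp => //; apply: emeasurable_nondecreasing => // x y Dx Dy xy.
by rewrite leeN2; exact: fmon.
Qed.

(** The density of dt/t extended by 0 to the line, so that Tonelli's theorem can
    be applied on the whole plane; a power rather than an inverse, for the sake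
    of measurability. *)
Let invD (t : R) : \bar R := ((fun t : R => (t `^ (-1))%:E) \_ pos) t.

Let invDE t : 0 < t -> invD t = (t^-1)%:E.
Proof.
move=> t0; rewrite /invD patchE mem_set; last exact/posE.
by rewrite powR_inv1// ltW.
Qed.

Let invD_ge0 t : (0 <= invD t)%E.
Proof. by rewrite /invD patchE; case: ifP => // _; rewrite lee_fin powR_ge0. Qed.

Let invD_meas : measurable_fun setT invD.
Proof.
apply/(measurable_restrictT _ _).1 => //; apply/measurable_EFinP.
by apply: measurable_funTS; exact: measurable_powR.
Qed.

Lemma measurable_mul_inv (g : R -> \bar R) : measurable_fun pos g ->
  measurable_fun pos (fun t => (g t * (t^-1)%:E)%E).
Proof.
move=> mg; apply: (eq_measurable_fun (fun t => (g t * invD t)%E)).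
  by move=> t /set_mem/posE t0; rewrite invDE.
by apply: emeasurable_funM => //; exact: measurable_funTS.
Qed.

(** A change of variables u = t^-beta up to a constant.  Since the du/u-mass of
    [s, 2s] is at least 1/2, phi(t) is at most twice the integral of G(u) du/u
    over 1 <= u t^beta <= 2; after Tonelli's theorem the remaining integral of
    dt/t over this same region, at fixed u, is at most 2^(1/beta). *)
Lemma le_integral_dtt_powR (beta : R) (phi G : R -> \bar R) : 0 < beta ->
  measurable_fun pos phi -> measurable_fun pos G ->
  (forall t, 0 < t -> (0 <= phi t)%E) -> (forall u, 0 < u -> (0 <= G u)%E) ->
  (forall t u, 0 < t -> 0 < u -> 1 <= u * t `^ beta <= 2 -> (phi t <= G u)%E) ->
  (\int[mu]_(t in pos) (phi t * (t^-1)%:E) <=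
   (2 * 2 `^ beta^-1)%:E * \int[mu]_(u in pos) (G u * (u^-1)%:E))%E.
Proof.
move=> b0 mphi mG phi0 G0 phiG.
pose S : set (R * R) := [set z | 1 <= z.2 * z.1 `^ beta <= 2].
have mS : measurable S.
  rewrite (_ : S = (fun z : R * R => z.2 * z.1 `^ beta) @^-1` `[1, 2]); last first.
    by apply/seteqP; split => z; rewrite /S/= in_itv.
  rewrite -[X in measurable X]setTI.
  have mf : measurable_fun setT (fun z : R * R => z.2 * z.1 `^ beta).
    apply: measurable_funM => //.
    by apply: (measurableT_comp (measurable_powR _)).
  exact: mf.
pose W := (fun u => (G u * (u^-1)%:E)%E) \_ pos.
have W0 u : (0 <= W u)%E.
  rewrite /W patchE; case: ifP => // /set_mem/posE u0.
  by rewrite mule_ge0 ?G0// lee_fin invr_ge0 ltW.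
have mW : measurable_fun setT W.
  by apply/(measurable_restrictT _ _).1 => //; exact: measurable_mul_inv.
pose h (z : R * R) := (invD z.1 * W z.2 * (\1_S z)%:E)%E.
have mh : measurable_fun setT h.
  apply: emeasurable_funM; last by apply/measurable_EFinP; exact: measurable_indic.
  apply: emeasurable_funM.
    exact: (measurableT_comp invD_meas).
  exact: (measurableT_comp mW).
have h0 z : (0 <= h z)%E.
  by rewrite /h !mule_ge0// lee_fin indicE ler0n.
have mh1 : measurable_fun setT (fun t => (\int[mu]_u h (t, u))%E).
  exact: measurable_fun_fubini_tonelli_F.
have mh2 : measurable_fun setT (fun u => (\int[mu]_t h (t, u))%E).
  exact: measurable_fun_fubini_tonelli_G.
apply: (@le_trans _ _ (\int[mu]_(t in pos) (2%:E * \int[mu]_u h (t, u)))%E).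
  apply: ge0_le_integral => //.
  - move=> t /posE t0; apply: mule_ge0; first exact: phi0.
    by rewrite lee_fin invr_ge0 ltW.
  - exact: measurable_mul_inv.
  - apply: measurable_funeM; apply: measurable_funTS; exact: mh1.
  move=> t /posE t0.
  have tb0 : 0 < t `^ beta by exact: powR_gt0.
  pose s := (t `^ beta)^-1.
  have s0 : 0 < s by rewrite invr_gt0.
  have phit0 := phi0 t t0.
  (* On [s, 2s] the density 1/u is at least 1/(2s), whose integral is 1/2. *)
  have -> : (phi t * (t^-1)%:E =
     2%:E * \int[mu]_(u in [set` `[s, 2 * s]%R]) (cst (phi t * (t^-1 * (2 * s)^-1)%:E) u))%E.
    rewrite integral_cst//= lebesgue_measure_itv/= lte_fin ltr_pMl// ltr1n.
    rewrite -EFinB -muleA -EFinM muleCA -EFinM; congr (_ * _%:E)%E.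
    by field; rewrite !gt_eqF.
  rewrite lee_pmul2l// integral_mkcond; apply: ge0_le_integral => //.
  - move=> u _; rewrite patchE; case: ifP => // _.
    by rewrite mule_ge0// lee_fin mulr_ge0// ?invr_ge0 ltW// mulr_gt0.
  - by apply/(measurable_restrictT _ _).1.
  - exact: (measurableT_comp mh).
  move=> u _; rewrite patchE; case: ifP => [/set_mem|_]; last exact: h0.
  rewrite /= in_itv/= => /andP[su us].
  have u0 : 0 < u by exact: lt_le_trans su.
  have Stu : 1 <= u * t `^ beta <= 2.
    by rewrite -ler_pdivrMr// div1r su/= -ler_pdivlMr.
  rewrite /h/= indicE mem_set// mule1 invDE// /W patchE mem_set; last exact/posE.
  rewrite [leRHS]muleCA -EFinM lee_pmul//.
  - by rewrite lee_fin mulr_ge0// ?invr_ge0 ltW// mulr_gt0.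
  - exact: phiG.
  by rewrite lee_fin ler_pM2l ?invr_gt0// lef_pV2 ?posrE// mulr_gt0.
rewrite ge0_integralZl//; last 2 first.
- by apply: measurable_funTS; exact: mh1.
- by move=> t _; exact: integral_ge0.
rewrite EFinM -muleA lee_pmul2l//.
apply: (@le_trans _ _ (\int[mu]_t \int[mu]_u h (t, u))%E).
  apply: ge0_subset_integral; [by []|by []|exact: mh1| |by []].
  by move=> t _; exact: integral_ge0.
rewrite fubini_tonelli//.
rewrite [X in (_ * X)%E](_ : _ = \int[mu]_u W u)%E; last first.
  by rewrite integral_mkcond.
rewrite -ge0_integralZl; [|by []|exact: mW|by []|]; last first.
  by rewrite lee_fin powR_ge0.
apply: ge0_le_integral; [by []| |exact: mh2| |].
- by move=> u _; exact: integral_ge0.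
- apply: measurable_funeM; exact: mW.
move=> u _; have [u0|u0] := ltP 0 u; last first.
  have Wu0 : W u = 0%E.
    by rewrite /W patchE memNset//; move/posE; rewrite ltNge u0.
  rewrite (_ : (fun t => h (t, u)) = cst 0%E).
    by rewrite integral0 Wu0 mule0.
  by apply/funext => t; rewrite /h/= Wu0 mule0 mul0e.
(* At fixed u > 0 the section of S lies in [a, b], where 1/t is at most 1/a. *)
pose a := u^-1 `^ beta^-1; pose b := 2 `^ beta^-1 * a.
have a0 : 0 < a by rewrite powR_gt0// invr_gt0.
apply: (@le_trans _ _ (\int[mu]_(t in `[a, b]) (cst ((a^-1)%:E * W u) t))%E); last first.
  rewrite integral_cst// [leLHS]muleC muleA; apply: lee_wpmul2r; first exact: W0.
  rewrite /= lebesgue_measure_itv/=; case: ifP => ab; last first.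
    by rewrite mul0e lee_fin powR_ge0.
  rewrite -EFinB -EFinM lee_fin /b ler_pdivrMr//.
  by rewrite lerBlDr lerDl ltW.
rewrite [leRHS]integral_mkcond; apply: ge0_le_integral => //.
- exact: (measurableT_comp mh).
- by apply/(measurable_restrictT _ _).1.
move=> t _; rewrite /h/= indicE.
have [Stu|nS] := boolP ((t, u) \in S); last first.
  rewrite mule0 patchE; case: ifP => // _.
  by rewrite mule_ge0// lee_fin invr_ge0 ltW.
rewrite mule1.
have [t0|t0] := ltP 0 t; last first.
  rewrite (_ : invD t = 0%E) ?mul0e; last first.
    by rewrite /invD patchE memNset//; move/posE; rewrite ltNge t0.
  rewrite patchE; case: ifP => // _.
  by rewrite mule_ge0// lee_fin invr_ge0 ltW.
move: Stu => /set_mem; rewrite /S/= => /andP[S1 S2].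
have tE : t = (t `^ beta) `^ beta^-1.
  by rewrite -powRrM mulfV ?gt_eqF// powRr1// ltW.
have at_ : a <= t.
  rewrite tE ge0_ler_powR ?nnegrE ?invr_ge0 ?powR_ge0 ?(ltW b0) ?(ltW u0)//.
  by rewrite -div1r ler_pdivrMr// mulrC.
have tb : t <= b.
  rewrite /b /a -powRM ?invr_ge0 ?(ltW u0)// tE.
  rewrite ge0_ler_powR ?nnegrE ?mulr_ge0 ?invr_ge0 ?powR_ge0 ?(ltW b0) ?(ltW u0)//.
  by rewrite ler_pdivlMr// mulrC.
rewrite patchE mem_set/=; last by rewrite in_itv/= at_ tb.
apply: lee_wpmul2r => //; rewrite invDE// lee_fin lef_pV2 ?posrE//.
Qed.

End Integral.

(** * Pointwise comparison of the approximation and K-functionals *)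

Section Pointwise.
Context {R : realType} {k : fieldType} {A : lmodType k}.
Implicit Types E F P : quasiNormedSpace R A.
Local Notation pos := (`]0, +oo[%classic : set R).

Lemma Kfunctional_ge0 E F f (t : R) : 0 <= t -> (0 <= Kfunctional E F f t)%E.
Proof.
move=> t0; apply/ereal_infP => _ [f0 [f1 [Ef0 Ff1 _ ->]]].
by rewrite lee_fin addr_ge0 ?mulr_ge0 ?qnorm_ge0.
Qed.

Lemma le_Kfunctional E F f (s t : R) : s <= t ->
  (Kfunctional E F f s <= Kfunctional E F f t)%E.
Proof.
move=> st; apply/ereal_infP => _ [f0 [f1 [Ef0 Ff1 ff ->]]].
apply: ge_ereal_inf; exists (qnorm E f0 + s * qnorm F f1)%:E.
  by exists f0, f1.
by rewrite lee_fin lerD2l ler_wpM2r ?qnorm_ge0.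
Qed.

Lemma approx_functional_ge0 E P f (t : R) : (0 <= approx_functional E P f t)%E.
Proof.
by apply/ereal_infP => _ [g [_ _ Efg ->]]; rewrite lee_fin qnorm_ge0.
Qed.

Lemma ge_approx_functional E P f (s t : R) : s <= t ->
  (approx_functional E P f t <= approx_functional E P f s)%E.
Proof.
move=> st; apply: ereal_inf_le_tmp => _ [g [Pg gs Efg ->]].
by exists g; split=> //; exact: le_trans st.
Qed.

(** If g approximates f1, it approximates f0 + f1 with the extra error f0. *)
Lemma approx_functionalD E P : exists2 CE : R, 1 < CE &
  forall f0 f1 (t : R), f0 \in E ->
  (approx_functional E P (f0 + f1) t <=
   CE%:E * ((qnorm E f0)%:E + approx_functional E P f1 t))%E.
Proof.
have [CE CE1 normD] := qnormD E; exists CE => // f0 f1 t Ef0.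
have CE0 : 0 < CE by exact: lt_trans CE1.
rewrite -lee_pdivrMl// -leeBlDl//; apply/ereal_infP => _ [g [Pg gt Ef1g ->]].
rewrite leeBlDl// lee_pdivrMl// -EFinD -EFinM.
have Efg : f0 + f1 - g \in E by rewrite -addrA rpredD.
apply: ge_ereal_inf; exists (qnorm E (f0 + f1 - g))%:E; first by exists g.
by rewrite lee_fin -addrA normD.
Qed.

(** The heart of the matter: Jackson's inequality bounds the approximation error
    of the F-part of any splitting of f, the E-part being left as an error.
    Both constants involved, 1 and C, are at most 1 + C. *)
Lemma approx_functional_le_Kfunctional E F P (C beta : R) :
  0 < C ->
  (forall f, f \in F -> forall t : R, 0 < t ->
     ((t `^ beta)%:E * approx_functional E P f t <= (C * qnorm F f)%:E)%E) ->
  exists2 M : R, 0 < M & forall f (t : R), 0 < t ->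
    (approx_functional E P f t <= M%:E * Kfunctional E F f (t `^ beta)^-1)%E.
Proof.
move=> C0 jackson; have [CE CE1 approxD] := approx_functionalD E P.
have CE0 : 0 < CE by exact: lt_trans CE1.
have M0 : 0 < CE * (1 + C) by rewrite mulr_gt0// addr_gt0.
exists (CE * (1 + C)) => // f t t0; have tb0 : 0 < t `^ beta by exact: powR_gt0.
rewrite -lee_pdivrMl//; apply/ereal_infP => _ [f0 [f1 [Ef0 Ff1 -> ->]]].
rewrite lee_pdivrMl//; apply: (le_trans (approxD _ _ _ Ef0)).
rewrite EFinM -muleA lee_pmul2l//.
have := jackson _ Ff1 _ t0; rewrite -lee_pdivlMl// => approx_f1.
apply: (le_trans (leeD (lexx _) approx_f1)).
rewrite -EFinM -EFinD -EFinM lee_fin.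
have n0 := qnorm_ge0 Ef0.
have n1 : 0 <= (t `^ beta)^-1 * qnorm F f1.
  by rewrite mulr_ge0 ?qnorm_ge0// invr_ge0 ltW.
rewrite mulrCA mulrDl mul1r mulrDr.
rewrite lerD ?ler_peMl//; nra.
Qed.

(** The K-functional is nondecreasing in its parameter, so its value at t^-beta may
    be replaced by the value at any u >= t^-beta, while u <= 2 t^-beta costs only
    a factor 2^theta in the weight.  The freedom in u is what the averaging
    argument for the integrals needs. *)
Lemma weighted_approx_le_Kfunctional E F P (C beta theta : R) :
  0 < C -> 0 < theta ->
  (forall f, f \in F -> forall t : R, 0 < t ->
     ((t `^ beta)%:E * approx_functional E P f t <= (C * qnorm F f)%:E)%E) ->
  exists2 M : R, 0 < M & forall f (t u : R), 0 < t -> 0 < u ->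
    1 <= u * t `^ beta <= 2 ->
    ((t `^ (theta * beta))%:E * approx_functional E P f t <=
     M%:E * ((u `^ (- theta))%:E * Kfunctional E F f u))%E.
Proof.
move=> C0 th0 /(approx_functional_le_Kfunctional C0)[M M0 approxK].
exists (2 `^ theta * M); first by rewrite mulr_gt0// powR_gt0.
move=> f t u t0 u0 /andP[ut1 ut2].
have tb0 : 0 < t `^ beta by exact: powR_gt0.
have weight : t `^ (theta * beta) <= 2 `^ theta * u `^ (- theta).
  rewrite mulrC powRrM powRN ler_pdivlMr ?powR_gt0//.
  by rewrite -powRM ?(ltW u0) ?(ltW tb0)// ge0_ler_powR ?nnegrE ?mulr_ge0// 1?mulrC// ltW.
apply: (@le_trans _ _ ((2 `^ theta * u `^ (- theta))%:E *
                       (M%:E * Kfunctional E F f u))%E).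
  apply: lee_pmul.
  - by rewrite lee_fin powR_ge0.
  - exact: approx_functional_ge0.
  - by rewrite lee_fin.
  apply: (le_trans (approxK _ _ t0)); rewrite lee_pmul2l//.
  by apply: le_Kfunctional; rewrite -div1r ler_pdivrMr.
by rewrite !EFinM -!muleA lee_pmul2l ?lte_fin ?powR_gt0// muleCA.
Qed.

Lemma measurable_weighted_Kfunctional E F f (a : R) :
  measurable_fun pos (fun t => ((t `^ a)%:E * Kfunctional E F f t)%E).
Proof.
apply: emeasurable_funM.
  by apply/measurable_EFinP; apply: measurable_funTS; exact: measurable_powR.
apply: emeasurable_nondecreasing; first exact: interval_is_interval.
by move=> s t _ _; exact: le_Kfunctional.
Qed.

Lemma measurable_weighted_approx E P f (a : R) :
  measurable_fun pos (fun t => ((t `^ a)%:E * approx_functional E P f t)%E).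
Proof.
apply: emeasurable_funM.
  by apply/measurable_EFinP; apply: measurable_funTS; exact: measurable_powR.
apply: emeasurable_nonincreasing; first exact: interval_is_interval.
by move=> s t _ _; exact: ge_approx_functional.
Qed.

End Pointwise.

(** * Comparison of the L^q(dt/t) quasi-norms *)

Section Lq.
Context {R : realType}.
Local Notation pos := (`]0, +oo[%classic : set R).

Lemma le_poweR (r : R) (x y : \bar R) : 0 <= r -> (0 <= x)%E -> (x <= y)%E ->
  (x `^ r <= y `^ r)%E.
Proof.
move=> r0 x0 xy; apply: (gt0_ler_poweR r0) => //; rewrite in_itv/= leey andbT//.
exact: le_trans xy.
Qed.

(** For finite q the integral comparison is applied to the q-th powers; for
    q = +oo the choice u = t^-beta suffices.  The constant does not depend on
    the functions compared. *)
Lemma Lq_dtt_powR_le (beta M : R) (q : \bar R) : 0 < beta -> 0 < M -> (0 < q)%E ->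
  exists2 N : R, 0 < N & forall phi psi : R -> \bar R,
    measurable_fun pos phi -> measurable_fun pos psi ->
    (forall t, 0 < t -> (0 <= phi t)%E) -> (forall u, 0 < u -> (0 <= psi u)%E) ->
    (forall t u, 0 < t -> 0 < u -> 1 <= u * t `^ beta <= 2 ->
      (phi t <= M%:E * psi u)%E) ->
    (Lq_dtt q phi <= N%:E * Lq_dtt q psi)%E.
Proof.
move=> b0 M0; case: q => [r||]// q0.
- have r0 : 0 < r by rewrite -lte_fin.
  pose c : R := 2 * 2 `^ beta^-1.
  have c0 : 0 < c by rewrite mulr_gt0// powR_gt0.
  exists (c `^ r^-1 * M); first by rewrite mulr_gt0// powR_gt0.
  move=> phi psi mphi mpsi phi0 psi0 phi_psi /=.
  have Mr0 : 0 <= M `^ r by exact: powR_ge0.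
  have mpow (g : R -> \bar R) : measurable_fun pos g ->
      measurable_fun pos (fun t => g t `^ r)%E.
    exact: (measurableT_comp (measurable_poweR r)).
  pose G u := ((M `^ r)%:E * psi u `^ r)%E.
  have /= := @le_integral_dtt_powR _ beta (fun t => phi t `^ r)%E G b0.
  move=> /(_ (mpow _ mphi) (measurable_funeM _ (mpow _ mpsi))).
  move=> /(_ (fun t _ => poweR_ge0 _ _)).
  have G0 u : 0 < u -> (0 <= G u)%E.
    by move=> _; rewrite mule_ge0 ?poweR_ge0// lee_fin.
  move=> /(_ G0) le_int.
  have {}le_int : (\int[lebesgue_measure]_(t in pos) (phi t `^ r * (t^-1)%:E) <=
      (c * M `^ r)%:E *
      \int[lebesgue_measure]_(u in pos) (psi u `^ r * (u^-1)%:E))%E.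
    rewrite EFinM -muleA -ge0_integralZl_EFin//; last 2 first.
    + move=> u /posE u0; rewrite mule_ge0 ?poweR_ge0// lee_fin invr_ge0 ltW//.
    + by apply: measurable_mul_inv; exact: mpow.
    under [X in (_ <= _ * X)%E]eq_integral do rewrite muleA.
    apply: le_int => t u t0 u0 tu.
    rewrite /G -poweR_EFin -poweRM ?psi0 ?lee_fin ?(ltW M0)//.
    by apply: le_poweR; [exact: ltW|exact: phi0|exact: phi_psi].
  have int_ge0 (g : R -> \bar R) :
      (0 <= \int[lebesgue_measure]_(t in pos) (g t `^ r * (t^-1)%:E))%E.
    apply: integral_ge0 => t /posE t0.
    by rewrite mule_ge0 ?poweR_ge0// lee_fin invr_ge0 ltW.
  rewrite (_ : c `^ r^-1 * M = (c * M `^ r) `^ r^-1); last first.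
    rewrite powRM ?(ltW c0)// -powRrM mulfV ?gt_eqF// powRr1// ltW//.
  have cM0 : 0 <= c * M `^ r by rewrite mulr_ge0// ltW.
  rewrite -poweR_EFin -poweRM ?lee_fin//.
  by apply: le_poweR; rewrite ?invr_ge0 ?(ltW r0).
- exists M => // phi psi _ _ phi0 psi0 phi_psi /=.
  apply: ge_ereal_sup => _ [t /posE t0 <-].
  have u0 : 0 < (t `^ beta)^-1 by rewrite invr_gt0 powR_gt0.
  apply: (le_trans (phi_psi t _ t0 u0 _)).
    by rewrite mulVf ?gt_eqF ?powR_gt0// lexx ler1n.
  rewrite lee_pmul2l//; apply: ereal_sup_ubound.
  by exists (t `^ beta)^-1 => //; exact/posE.
Qed.

End Lq.

(** * The embedding *)

Theorem theorem4p5 (R : realType) (k : fieldType) (A : lmodType k)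
  (E F P : quasiNormedSpace R A)
  (EF_pair : compatible_pair E F) (EP_pair : compatible_pair E P)
  (subPF : {subset P <= F}) (subFE : {subset F <= E})
  (E_complete : qcomplete E) (F_complete : qcomplete F)
  (C beta : R) (C_gt0 : 0 < C) (beta_gt0 : 0 < beta)
  (jackson : forall (f : A), f \in F -> forall t : R, 0 < t ->
     ((t `^ beta)%:E * approx_functional E P f t <= (C * qnorm F f)%:E)%E)
  (theta : R) (q : \bar R) (theta_gt0 : 0 < theta) (theta_lt1 : theta < 1)
  (q_gt1 : (1%:E < q)%E) :
  embedding (interp_space E F theta q) (interp_qnorm E F theta q)
    (approx_space E P (theta * beta) q) (approx_qnorm E P (theta * beta) q).
Proof.
have [M M0 pointwise] := weighted_approx_le_Kfunctional C_gt0 theta_gt0 jackson.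
have q_gt0 : (0 < q)%E by apply: lt_trans q_gt1; rewrite lte_fin.
have [N N0 LqN] := Lq_dtt_powR_le beta_gt0 M0 q_gt0.
have K_ge0 f u : 0 < u -> (0 <= (u `^ (- theta))%:E * Kfunctional E F f u)%E.
  by move=> u0; rewrite mule_ge0 ?Kfunctional_ge0 ?lee_fin ?powR_ge0// ltW.
have bound f :
    (approx_qnorm E P (theta * beta) q f <= N%:E * interp_qnorm E F theta q f)%E.
  apply: LqN; [exact: measurable_weighted_approx|
               exact: measurable_weighted_Kfunctional| |exact: K_ge0|].
  - by move=> t _; rewrite mule_ge0 ?approx_functional_ge0// lee_fin powR_ge0.
  - exact: pointwise.
split; last by exists N.
move=> f [[f0 [f1 [Ef0 Ff1 ff]]] f_fin]; split.
  by exists f, 0; split; rewrite ?rpred0 ?addr0// ff rpredD// subFE.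
apply: (le_lt_trans (bound f)); apply: lte_mul_pinfty => //.
by rewrite lee_fin ltW.
Qed.
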